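(* Let $(X,d_X,\mu_X)$ be a bounded metric measure space with $\mu_X(X)=1$ whose measure $\mu_X$ is doubling with doubling constant $C$. Let $0<\varepsilon\le 1/2$ and $\rho>0$, and assume that $\mathrm{Exp}_{\mathrm{Ledoux}}(X;\varepsilon,\rho)$ and $\mathrm{Exp}_{\mathrm{Ledoux}}(X;1-\varepsilon,\rho)$ are finite and $$\min\{\mathrm{Exp}_{\mathrm{Ledoux}}(X;\varepsilon,\rho),\ \mathrm{Exp}_{\mathrm{Ledoux}}(X;1-\varepsilon,\rho)\}>1.$$ Then $$\mathrm{diam}(X)\ \le\ 3\rho\,\max\left\{\frac{\ln\left(C^4(1-\varepsilon)\varepsilon^{-1}\,\mathrm{Exp}_{\mathrm{Ledoux}}(X;1-\varepsilon,\rho)\right)}{\ln\mathrm{Exp}_{\mathrm{Ledoux}}(X;1-\varepsilon,\rho)},\ \frac{2\ln\left(C^3\,3^{\ln C/\ln 2}\,\varepsilon\,\mathrm{Exp}_{\mathrm{Ledoux}}(X;\varepsilon,\rho)\right)}{\ln\mathrm{Exp}_{\mathrm{Ledoux}}(X;\varepsilon,\rho)}\right\}.$$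
   Context: A metric measure space $(X,d_X,\mu_X)$ is a metric space $(X,d_X)$ with a finite Borel measure $\mu_X$; throughout $\mu_X(X)=1$. $\mathrm{diam}(X)=\sup\{d_X(x,y):x,y\in X\}$. For $A\subset X$ and $r\ge 0$, $A_r=\{x\in X: d_X(x,A)\le r\}$. $B(x,r)$ is the ball of centre $x$ and radius $r$. A Borel measure $\mu_X$ is doubling if it is finite on bounded sets and there is a constant $C$ with $\mu_X(B(x,2r))\le C\,\mu_X(B(x,r))$ for all $x\in X$ and $r>0$; the best such constant $C\ (\ge 1)$ is the doubling constant. Ledoux's expansion coefficient ($0<\varepsilon<1$, $\rho>0$): $\mathrm{Exp}_{\mathrm{Ledoux}}(X;\varepsilon,\rho)$ is the supremum of all real $e\ge1$ such that $\mu_X(B_\rho)\ge e\,\mu_X(B)$ for every Borel set $B\subset X$ with $\mu_X(B_\rho)\le\varepsilon$. *)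

(* Defs.v *)
From HB Require Import structures.
From mathcomp Require Import all_boot all_order all_algebra.
From mathcomp Require Import all_classical all_reals all_analysis.

Set Implicit Arguments.
Unset Strict Implicit.
Unset Printing Implicit Defensive.

Import Order.TTheory GRing.Theory Num.Def Num.Theory.

Local Open Scope classical_set_scope.
Local Open Scope ring_scope.

(* Measurable types are pointed in the library; a space of total mass 1 is
   nonempty, so choosing a point is no restriction. *)
#[short(type="pMetricType")]
HB.structure Definition PointedMetric (K : numDomainType) :=
  { M of Pointed M & Metric K M }.

Notation borel X := (g_sigma_algebraType (@open X)).

Section metric.
Context {R : realType} {X : metricType R}.
Implicit Types (A : set X) (x y : X) (r : R).

Definition metric_bounded A : Prop :=
  exists M : R, forall x y, A x -> A y -> mdist x y <= M.

Definition diameter A : \bar R :=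
  ereal_sup [set (mdist xy.1 xy.2)%:E | xy in A `*` A].

(* [edist] is the distance of the metric space, so that [edist_inf A x] below
   is the usual distance from [x] to [A] (equal to [+oo] if [A] is empty). *)
Lemma edist_mdist x y : edist (x, y) = (mdist x y)%:E.
Proof.
apply/eqP; rewrite eq_le; apply/andP; split.
  apply/lee_addgt0Pr => e e0; rewrite -EFinD.
  apply: edist_fin; first by rewrite ltr_wpDl// mdist_ge0.
  by rewrite ballEmdist/= ltrDl.
apply: le_ereal_inf_tmp => _ [r [r0 /= xyr] <-].
by rewrite lee_fin ltW//; move: xyr; rewrite ballEmdist.
Qed.

Definition closed_nbhd A r : set X := [set x | (edist_inf A x <= r%:E)%E].

End metric.

Section measure.
Context {R : realType} {X : pMetricType R}.
Variable mu : {measure set (borel X) -> \bar R}.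

(* [ball] is the open ball; closed balls give the same constants, by
   continuity of a measure that is finite on bounded sets. *)
Definition doubling_bound (C : R) : Prop :=
  forall (x : X) (r : R), 0 < r ->
    (mu (ball x (2 * r)) <= C%:E * mu (ball x r))%E.

Definition doubling : Prop :=
  (forall A : set (borel X), measurable A -> @metric_bounded R X A ->
     (mu A < +oo)%E) /\
  exists C : R, doubling_bound C.

Definition doubling_constant : R := inf [set C | doubling_bound C].

Definition ledoux_bound (eps rho e : R) : Prop :=
  forall B : set (borel X), measurable B ->
    (mu (@closed_nbhd R X B rho) <= eps%:E)%E ->
    (e%:E * mu B <= mu (@closed_nbhd R X B rho))%E.

Definition exp_ledoux (eps rho : R) : \bar R :=
  ereal_sup [set e%:E | e in [set e : R | 1 <= e /\ ledoux_bound eps rho e]].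

End measure.

(* Main.v *)
Require Import Defs.
From HB Require Import structures.
From mathcomp Require Import all_boot all_order all_algebra.
From mathcomp Require Import all_classical all_reals all_analysis.
From mathcomp Require Import ring lra.

Set Implicit Arguments.
Unset Strict Implicit.
Unset Printing Implicit Defensive.

Import Order.TTheory GRing.Theory Num.Def Num.Theory.

Local Open Scope classical_set_scope.
Local Open Scope ring_scope.


(** A set whose successive rho-enlargements stay below the mass threshold of an
    expansion coefficient e grows by a factor e at each enlargement, so its
    mass grows geometrically, while the total mass is 1.  Hence only
    logarithmically many enlargements fit inside the space, and a large
    diameter would leave room for too many.

    Fix x and y at distance d > diam X / 2.  Around each of them consider the
    closed ball of radius d/8 + d/6, a number smaller than d/3.

    If one of these balls has mass at most eps, start from the concentric ball
    of radius d/8.  Four doublings reach radius 2 d > diam X, hence the whole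
    space, so the starting mass is at least C^-4.  About d / (6 rho)
    enlargements fit before the mass can exceed eps, which bounds
    E1^(d / (6 rho) - 1) by C^4 eps ([le_thin_ball]).

    If both balls have mass at least eps, enlarge the ball around x.  For about
    d / (3 rho) steps it stays disjoint from the ball around y, hence of mass
    at most 1 - eps, which bounds E2^(d / (3 rho) - 1) by (1 - eps) / eps
    ([le_thick_balls]).

    Taking logarithms gives estimates at least as strong as the two terms of
    the maximum: for the first term because 1 <= C^4, for the second because
    C = 2^(ln C / ln 2) <= 3^(ln C / ln 2).  A diameter exceeding the bound
    would be witnessed by a pair x, y that also satisfies d > diam X / 2. *)

(** * Closed balls and their Borel measurability *)

Section metric_sets.
Context {R : realType} {X : pMetricType R}.
Implicit Types (x y z : X) (r s t : R) (A : set X).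

(** The ball defined by the large inequality; it may be strictly larger than
    the closure of the open ball. *)
Definition cball x r : set X := [set z | mdist x z <= r].

Lemma cball_sub x s t : s <= t -> cball x s `<=` cball x t.
Proof. by move=> st z /= /le_trans; apply. Qed.

Lemma ball_sub_cball x r : ball x r `<=` cball x r.
Proof. by move=> z; rewrite ballEmdist => /ltW. Qed.

Lemma open_borel A : open A -> measurable (A : set (borel X)).
Proof. by move=> oA; exact: sub_sigma_algebra. Qed.

Lemma closed_borel A : closed A -> measurable (A : set (borel X)).
Proof.
move=> cA; rewrite -(setCK A).
exact: (@measurableC _ (borel X) _ (open_borel (closed_openC cA))).
Qed.

Lemma ball_borel x r : measurable (ball x r : set (borel X)).
Proof.
apply: open_borel; rewrite openE => y; rewrite ballEmdist /= => xy.
rewrite /interior -nbhs_ballE; exists (r - mdist x y) => /=.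
  by rewrite subr_gt0.
move=> z; rewrite !ballEmdist /= ltrBrDl => yz.
exact: le_lt_trans (metric_triangle _ y _) yz.
Qed.

Lemma closed_nbhd_borel A r : measurable (closed_nbhd A r : set (borel X)).
Proof.
apply: closed_borel; apply: (@preimage_closed _ _ _ [set u | (u <= r%:E)%E]).
  by move=> z _; exact: edist_inf_continuous.
exact: closed_ereal_ge_ereal.
Qed.

Lemma cball_nbhd1 x r : cball x r = closed_nbhd [set x] r.
Proof.
apply/seteqP; split=> z; rewrite /cball /closed_nbhd /edist_inf /=;
  by rewrite image_set1 ereal_inf1 edist_mdist lee_fin metric_sym.
Qed.

Lemma cball_borel x r : measurable (cball x r : set (borel X)).
Proof. by rewrite cball_nbhd1; exact: closed_nbhd_borel. Qed.

Lemma closed_nbhd_cball x s r : closed_nbhd (cball x s) r `<=` cball x (s + r).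
Proof.
move=> z /= zr; apply/ler_addgt0Pr => e e0.
have : (edist_inf (cball x s) z < (r + e)%:E)%E.
  by apply: (le_lt_trans zr); rewrite lte_fin ltrDl.
move=> /ereal_inf_lt[_ [a /= xa <-]]; rewrite edist_mdist lte_fin => za.
rewrite (le_trans (metric_triangle _ a _))// -addrA lerD//.
by rewrite metric_sym ltW.
Qed.

Lemma cball_disjoint x y s t : s + t < mdist x y -> cball x s `&` cball y t = set0.
Proof.
move=> st; rewrite -subset0 => z [/= xz yz].
move: st; rewrite ltNge (le_trans (metric_triangle _ z _))//.
by rewrite lerD// metric_sym.
Qed.

End metric_sets.

(** * Consequences of doubling *)

Section doubling.
Context {R : realType} {X : pMetricType R} (mu : probability (borel X) R).
Implicit Types (x : X) (r C : R).

Lemma doubling_bound_iter C x r n : 0 < r -> 0 <= C -> doubling_bound mu C ->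
  (mu (ball x (2 ^+ n * r)) <= (C ^+ n)%:E * mu (ball x r))%E.
Proof.
move=> r0 C0 dC; elim: n => [|n IH]; first by rewrite !expr0 mul1r mul1e.
rewrite exprS -mulrA (le_trans (dC _ _ _))//.
  by rewrite mulr_gt0// exprn_gt0.
by rewrite exprS EFinM -muleA lee_wpmul2l ?lee_fin.
Qed.

Lemma prob_ball_full x r : (forall y z : X, mdist y z < r) ->
  mu (ball x r) = 1%E.
Proof.
move=> Xr; have -> : ball x r = [set: X].
  by apply/seteqP; split=> // y _; rewrite ballEmdist /=.
exact: probability_setT.
Qed.

(** Once the radius exceeds the diameter, a ball and its double both have mass
    1, so no constant below 1 can be a doubling bound. *)
Lemma doubling_bound_ge1 C : metric_bounded [set: X] -> doubling_bound mu C ->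
  1 <= C.
Proof.
move=> [M bM] dC.
have M0 : 0 <= M by apply: le_trans (bM point point I I); exact: mdist_ge0.
have lt (r : R) : M < r -> forall y z : X, mdist y z < r.
  by move=> Mr y z; exact: le_lt_trans (bM y z I I) Mr.
have : (mu (ball point (2 * (M + 1))) <= C%:E * mu (ball point (M + 1)))%E.
  exact: dC (ltr_wpDl M0 ltr01).
have full r : M < r -> mu (ball point r) = 1%E.
  by move=> /lt; exact: prob_ball_full.
by rewrite (full (2 * (M + 1))) ?(full (M + 1)) ?mule1 ?lee_fin//; lra.
Qed.

(** The infimum is attained: for each ball, a doubling bound is an upper bound
    on a fixed ratio of masses, and such inequalities pass to the infimum.
    When the smaller ball is null the ratio is meaningless, but then any
    doubling bound forces the larger ball to be null. *)
Lemma doubling_constantP : metric_bounded [set: X] -> doubling mu ->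
  doubling_bound mu (doubling_constant mu).
Proof.
move=> bX [_ [C0 dC0]] x r r0.
have fb t : mu (ball x t) = (fine (mu (ball x t)))%:E.
  by rewrite fineK// fin_num_measure//; exact: ball_borel.
have dE C : doubling_bound mu C ->
    fine (mu (ball x (2 * r))) <= C * fine (mu (ball x r)).
  move=> dC; rewrite -lee_fin EFinM -!fb; exact: dC.
suff : (mu (ball x (2 * r)) <= (doubling_constant mu)%:E * mu (ball x r))%E by [].
rewrite (fb (2 * r)) (fb r) -EFinM lee_fin.
have [m0|m0] := eqVneq (fine (mu (ball x r))) 0.
  by have := dE _ dC0; rewrite m0 !mulr0.
have mp : 0 < fine (mu (ball x r)) by rewrite lt_neqAle eq_sym m0 fine_ge0.
rewrite -ler_pdivrMr//; apply: lb_le_inf; first by exists C0.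
by move=> C /= /dE; rewrite ler_pdivrMr.
Qed.

End doubling.

(** * Geometric growth under expansion *)

Section expansion.
Context {R : realType} {X : pMetricType R} (mu : probability (borel X) R).
Implicit Types (x : X) (eps rho e r : R).

(** A finite supremum is attained, because each set B of positive mass only
    requires e to be at most the ratio of the masses of its enlargement and of
    B itself. *)
Lemma exp_ledouxP eps rho : exp_ledoux mu eps rho \is a fin_num ->
  ledoux_bound mu eps rho (fine (exp_ledoux mu eps rho)).
Proof.
move=> Efin B mB Beps.
have fB (A : set (borel X)) : measurable A -> mu A = (fine (mu A))%:E.
  by move=> mA; rewrite fineK// fin_num_measure.
pose N : set (borel X) := closed_nbhd B rho.
have mN : measurable N by exact: closed_nbhd_borel.
suff : ((fine (exp_ledoux mu eps rho))%:E * mu B <= mu N)%E by [].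
rewrite fineK//.
have [m0|m0] := eqVneq (mu B) 0%E; first by rewrite m0 mule0.
have mp : 0 < fine (mu B).
  rewrite -lte_fin -fB// lt_neqAle eq_sym m0/=; exact: measure_ge0.
rewrite (fB _ mB) -lee_pdivlMr//; apply: ge_ereal_sup => _ [e [e1 be] <-].
by rewrite lee_pdivlMr// -fB//; exact: be.
Qed.

(** By monotonicity the mass hypothesis on the largest ball covers all the
    intermediate ones, so the expansion inequality is available at every
    step. *)
Lemma ledoux_bound_iter eps rho e x r n : 0 < rho -> 0 <= e ->
  ledoux_bound mu eps rho e ->
  (mu (cball x (r + n%:R * rho)) <= eps%:E)%E ->
  ((e ^+ n)%:E * mu (cball x r) <= mu (cball x (r + n%:R * rho)))%E.
Proof.
move=> rho0 e0 be; elim: n => [|n IH]; first by rewrite mul0r addr0 mul1e.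
set t := r + n%:R * rho.
have -> : r + n.+1%:R * rho = t + rho by rewrite -natr1 /t; ring.
move=> teps.
have leB : (mu (cball x t) <= mu (cball x (t + rho)))%E.
  apply: le_measure; rewrite ?inE; try exact: cball_borel.
  by apply: cball_sub; rewrite lerDl ltW.
have leN : (mu (closed_nbhd (cball x t) rho) <= mu (cball x (t + rho)))%E.
  apply: le_measure; rewrite ?inE; first exact: closed_nbhd_borel.
    exact: cball_borel.
  exact: closed_nbhd_cball.
apply: (le_trans _ leN).
apply: le_trans (be _ (cball_borel _ _) (le_trans leN teps)).
rewrite exprS EFinM -muleA lee_wpmul2l ?lee_fin//.
exact: IH (le_trans leB teps).
Qed.

(** The largest n with n rho <= L exceeds L / rho - 1; the extra factor e under
    the logarithm pays for this rounding. *)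
Lemma steps_log_bound (rho e L K : R) : 0 < rho -> 1 < e -> 0 <= L -> 0 < K ->
  (forall n, n%:R * rho <= L -> e ^+ n <= K) -> L <= rho * (ln (K * e) / ln e).
Proof.
move=> rho0 e1 L0 K0 step.
have e0 : 0 < e by exact: lt_trans e1.
have lne : 0 < ln e by exact: ln_gt0.
set n := Num.truncn (L / rho).
have /andP[nL Ln] : n%:R <= L / rho < n.+1%:R.
  by apply: truncn_itv; rewrite divr_ge0// ltW.
have := step n; rewrite -ler_pdivlMr// => /(_ nL) en.
rewrite mulrC -ler_pdivrMr// ler_pdivlMr//.
have : ln (e ^+ n) <= ln K by rewrite ler_ln ?posrE ?exprn_gt0.
rewrite lnXn// lnM ?posrE// => lnK.
apply: (@le_trans _ _ (n.+1%:R * ln e)); first by rewrite ler_wpM2r// ltW.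
by rewrite mulr_natl mulrSr lerD2r.
Qed.

End expansion.

(** * The two cases for a pair of distant points *)

Section pairs.
Context {R : realType} {X : pMetricType R} (mu : probability (borel X) R).
Implicit Types (x y z : X) (C eps rho e d : R).

(** Doubling makes the ball of radius d/8 heavy, while the ball of radius
    d/8 + d/6 is light: the annulus between them, of width d/6, leaves little
    room for geometric growth. *)
Lemma le_thin_ball C eps rho e d z : 1 <= C -> doubling_bound mu C ->
  0 < d -> (forall u v : X, mdist u v < 2 * d) -> 0 < eps -> 0 < rho -> 1 < e ->
  ledoux_bound mu eps rho e ->
  (mu (cball z (d / 8 + d / 6)) <= eps%:E)%E ->
  d / 6 <= rho * (ln (C ^+ 4 * eps * e) / ln e).
Proof.
move=> C1 dC d0 Xd eps0 rho0 e1 be zeps.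
have C0 : 0 < C by exact: lt_le_trans C1.
apply: steps_log_bound => //; first by rewrite divr_ge0// ltW.
  by rewrite mulr_gt0// exprn_gt0.
move=> n nd.
have mono s t : s <= t -> (mu (cball z s) <= mu (cball z t))%E.
  move=> st; apply: le_measure; rewrite ?inE; try exact: cball_borel.
  exact: cball_sub.
have small : (mu (cball z (d / 8 + n%:R * rho)) <= eps%:E)%E.
  by apply: le_trans zeps; apply: mono; rewrite lerD2l.
have := le_trans (ledoux_bound_iter rho0 (ltW (lt_trans ltr01 e1)) be small) small.
have : (1 <= (C ^+ 4)%:E * mu (cball z (d / 8)))%E.
  have -> : 1%E = mu (ball z (2 ^+ 4 * (d / 8))).
    rewrite prob_ball_full// => u v.
    by apply: lt_le_trans (Xd u v) _; lra.
  apply: le_trans (doubling_bound_iter _ _ _ (ltW C0) dC) _; first lra.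
  rewrite lee_wpmul2l ?lee_fin ?exprn_ge0 ?(ltW C0)//.
  apply: le_measure; rewrite ?inE; [exact: ball_borel|exact: cball_borel|].
  exact: ball_sub_cball.
have -> : mu (cball z (d / 8)) = (fine (mu (cball z (d / 8))))%:E.
  by rewrite fineK// fin_num_measure//; exact: cball_borel.
(* Multiplying 1 <= C^4 m by e^n turns e^n m <= eps into e^n <= C^4 eps. *)
rewrite -!EFinM !lee_fin; set m := fine _ => Cm em.
have en0 : 0 <= e ^+ n by rewrite exprn_ge0// ltW// (lt_trans ltr01).
apply: (@le_trans _ _ (e ^+ n * (C ^+ 4 * m))); first by rewrite ler_peMr.
by rewrite mulrCA ler_wpM2l// exprn_ge0// ltW.
Qed.

(** Growth starts from mass eps around x, and is stopped at mass 1 - eps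
    by the mass eps around y.  As 2 (d/8 + d/6) + d/3 < d, the ball around x
    can be enlarged by d/3 and still miss the ball around y. *)
Lemma le_thick_balls eps rho e d x y : d = mdist x y -> 0 < d ->
  0 < eps -> eps < 1 -> 0 < rho -> 1 < e ->
  ledoux_bound mu (1 - eps) rho e ->
  (eps%:E <= mu (cball x (d / 8 + d / 6)))%E ->
  (eps%:E <= mu (cball y (d / 8 + d / 6)))%E ->
  d / 3 <= rho * (ln ((1 - eps) * eps^-1 * e) / ln e).
Proof.
move=> dE d0 eps0 eps1 rho0 e1 be xeps yeps; set a := d / 8 + d / 6.
apply: steps_log_bound => //; first by rewrite divr_ge0// ltW.
  by rewrite divr_gt0// subr_gt0.
move=> n nd.
have small : (mu (cball x (a + n%:R * rho)) <= (1 - eps)%:E)%E.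
  rewrite EFinB leeBrDr//.
  apply: (@le_trans _ _ (mu (cball x (a + n%:R * rho)) + mu (cball y a))%E).
    by rewrite leeD2l.
  rewrite -measureU; [|exact: cball_borel|exact: cball_borel|].
    by apply: probability_le1; apply: measurableU; exact: cball_borel.
  by apply: cball_disjoint; rewrite -dE /a; lra.
have en0 : 0 <= e ^+ n by rewrite exprn_ge0// ltW// (lt_trans ltr01).
rewrite ler_pdivlMr// -lee_fin EFinM.
apply: le_trans (le_trans (ledoux_bound_iter rho0 (ltW (lt_trans ltr01 e1)) be small) small).
by rewrite lee_wpmul2l// lee_fin.
Qed.

End pairs.

Theorem theorem7p1 (R : realType) (X : pMetricType R)
    (mu : probability (borel X) R) (C eps rho : R)
    (bounded_X : metric_bounded [set: X])
    (doubling_mu : doubling mu)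
    (C_def : C = doubling_constant mu)
    (eps_gt0 : 0 < eps) (eps_le : eps <= 1 / 2) (rho_gt0 : 0 < rho)
    (exp1_fin : exp_ledoux mu eps rho \is a fin_num)
    (exp2_fin : exp_ledoux mu (1 - eps) rho \is a fin_num)
    (exp_gt1 : (1 < mine (exp_ledoux mu eps rho)
                         (exp_ledoux mu (1 - eps) rho))%E) :
  let E1 := fine (exp_ledoux mu eps rho) in
  let E2 := fine (exp_ledoux mu (1 - eps) rho) in
  (diameter [set: X] <=
    (3 * rho *
     maxr (ln (C ^+ 4 * (1 - eps) * eps^-1 * E2) / ln E2)
          (2 * ln (C ^+ 3 * 3 `^ (ln C / ln 2) * eps * E1) / ln E1))%:E)%E.
Proof.
cbv zeta.
set E1 := fine (exp_ledoux mu eps rho).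
set E2 := fine (exp_ledoux mu (1 - eps) rho).
have [E11 E21] : 1 < E1 /\ 1 < E2.
  move: exp_gt1; rewrite lt_min => /andP[h1 h2].
  by split; rewrite -lte_fin fineK.
have dC : doubling_bound mu C by rewrite C_def; exact: doubling_constantP.
have C1 : 1 <= C by exact: doubling_bound_ge1 dC.
have C0 : 0 < C by exact: lt_le_trans C1.
have bE1 : ledoux_bound mu eps rho E1 by exact: exp_ledouxP.
have bE2 : ledoux_bound mu (1 - eps) rho E2 by exact: exp_ledouxP.
have E10 : 0 < E1 by exact: lt_trans E11.
have E20 : 0 < E2 by exact: lt_trans E21.
have eps1 : eps < 1 by lra.
have C4 : C ^+ 4 <= C ^+ 3 * 3 `^ (ln C / ln 2).
  rewrite exprSr ler_wpM2l ?exprn_ge0 ?(ltW C0)//.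
  have ln2 : 0 < ln 2 :> R by apply: ln_gt0; lra.
  have {1}-> : C = 2 `^ (ln C / ln 2).
    by rewrite /powR pnatr_eq0 /= divfK ?gt_eqF// lnK.
  apply: ge0_ler_powR; rewrite ?nnegrE ?ler_nat//.
  by rewrite divr_ge0 ?(ltW ln2)// ln_ge0.
set M := maxr _ _.
have lnle (K K' E : R) : 1 < E -> 0 < K -> K <= K' ->
    ln (K * E) / ln E <= ln (K' * E) / ln E.
  move=> E_1 K0 KK'; have E_0 : 0 < E by exact: lt_trans E_1.
  rewrite ler_pM2r ?invr_gt0 ?ln_gt0// ler_ln ?posrE ?mulr_gt0 ?ler_pM2r//.
  exact: lt_le_trans KK'.
have pair (x y : X) : 0 < mdist x y -> (forall u v : X, mdist u v < 2 * mdist x y) ->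
    mdist x y <= 3 * rho * M.
  set d := mdist x y => d0 Xd.
  have thin z : (mu (cball z (d / 8 + d / 6)) <= eps%:E)%E ->
      d <= 3 * rho * M.
    move=> /(le_thin_ball C1 dC d0 Xd eps_gt0 rho_gt0 E11 bE1) dle.
    have {}dle : d / 6 <=
        rho * (ln (C ^+ 3 * 3 `^ (ln C / ln 2) * eps * E1) / ln E1).
      apply: (le_trans dle); rewrite ler_pM2l//; apply: lnle => //.
        by rewrite mulr_gt0// exprn_gt0.
      by rewrite ler_pM2r.
    apply: (@le_trans _ _ (3 * rho *
        (2 * ln (C ^+ 3 * 3 `^ (ln C / ln 2) * eps * E1) / ln E1))).
      by rewrite -(mulrA 2); lra.
    by rewrite ler_wpM2l ?le_max ?lexx ?orbT// mulr_ge0// ltW.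
  have [/thin//|/ltW xeps] := leP (mu (cball x (d / 8 + d / 6))) eps%:E.
  have [/thin//|/ltW yeps] := leP (mu (cball y (d / 8 + d / 6))) eps%:E.
  have dle := le_thick_balls erefl d0 eps_gt0 eps1 rho_gt0 E21 bE2 xeps yeps.
  have {}dle : d / 3 <=
      rho * (ln (C ^+ 4 * (1 - eps) * eps^-1 * E2) / ln E2).
    apply: (le_trans dle); rewrite ler_pM2l//; apply: lnle => //.
      by rewrite divr_gt0// subr_gt0.
    rewrite -mulrA ler_peMl ?divr_ge0 ?subr_ge0 ?(ltW eps1) ?(ltW eps_gt0)//.
    exact: exprn_ege1.
  apply: (@le_trans _ _ (3 * rho *
      (ln (C ^+ 4 * (1 - eps) * eps^-1 * E2) / ln E2))); first lra.
  by rewrite ler_wpM2l ?le_max ?lexx// mulr_ge0// ltW.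
have M0 : 0 <= M.
  rewrite le_max divr_ge0 ?ln_ge0 ?(ltW E21)//.
  have : 1 <= (1 - eps) / eps by rewrite ler_pdivlMr//; lra.
  move=> h; rewrite -(mulrA _ (1 - eps)).
  exact: mulr_ege1 (mulr_ege1 (exprn_ege1 4 C1) h) (ltW E21).
(* Only pairs with d > diam X / 2 are covered, so the argument is by
   contradiction: the supremum gives a pair beyond both thresholds. *)
rewrite leNgt; apply/negP => Mdiam.
have [D DE] : exists D, diameter [set: X] = D%:E.
  have [B bB] := bounded_X.
  exists (fine (diameter [set: X])); rewrite fineK// fin_numElt.
  rewrite (lt_trans _ Mdiam) ?ltNyr//=.
  apply: (@le_lt_trans _ _ B%:E); last exact: ltry.
  by apply: ge_ereal_sup => _ [[u v] _ <-]; rewrite lee_fin; exact: bB.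
have dD (u v : X) : mdist u v <= D.
  by rewrite -lee_fin -DE; apply: ereal_sup_ubound; exists (u, v).
move: Mdiam; rewrite DE lte_fin => MD.
have M3 : 0 <= 3 * rho * M by rewrite !mulr_ge0// ltW.
have : ((maxr (3 * rho * M) (D / 2))%:E < diameter [set: X])%E.
  by rewrite DE lte_fin gt_max MD /=; lra.
move=> /ereal_sup_gt[_ [[x y] _ <-]] /=; rewrite lte_fin gt_max => /andP[Mxy Dxy].
move: Mxy; rewrite ltNge pair//; first lra.
by move=> u v; apply: le_lt_trans (dD u v) _; lra.
Qed.
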